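(* Let $a,b,c,d$ be positive integers. There exist $m\ge2$ and a Kunz nilsemigroup $N=\mathbb Z_m\cup\{\infty\}$ with 3 outer Betti elements and shape $(a,b,c,d)$ if and only if $\gcd(a,b,c,d)=1$.
   Context: Kunz cone $\mathcal C_m\subseteq\mathbb R^{m-1}$ (coordinates indexed by nonzero residues of $\mathbb Z_m$, $x_0=0$): defined by $x_i+x_j\ge x_{i+j}$ for nonzero $i,j$ with $i+j\ne0$. A face with trivial Kunz subgroup (no $x_i$, $i\ne0$, vanishing identically on it) has Kunz nilsemigroup $\mathbb Z_m\cup\{\infty\}$ with nil element $\infty$ and $u\oplus v=u+v$ if $x_u+x_v=x_{u+v}$ on the whole face, $\infty$ otherwise; a Kunz nilsemigroup means one arising this way. Atoms: nonzero elements not a sum of two nonzero elements. For a nilsemigroup with exactly two atoms $p_1,p_2$, factorizations of $n$ are $z\in\mathbb Z^2_{\ge0}$ with $z_1p_1\oplus z_2p_2=n$; $N$ is staircase if every non-nil element has exactly one factorization, and then an outer Betti element is a vector $z$ with $z_1p_1\oplus z_2p_2=\infty$ such that $z-e_i$ is a factorization of a non-nil element for each $i$ with $z_i>0$. A staircase $N$ with two atoms $p_1,p_2$ and exactly three outer Betti elements has shape $(a,b,c,d)\in\mathbb Z_{\ge1}^4$ if (for a suitable ordering of the atoms) its outer Betti elements are $(a,c)$, $(a+b,0)$ and $(0,c+d)$; in this case $m=(a+b)(c+d)-bd$. *)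

(* Defs.v *)
From HB Require Import structures.
From mathcomp Require Import all_boot all_order all_algebra.
From mathcomp Require Import boolp classical_sets reals.
Set Implicit Arguments.
Unset Strict Implicit.
Unset Printing Implicit Defensive.
Import Order.TTheory GRing.Theory Num.Theory.
Local Open Scope classical_set_scope.
Local Open Scope ring_scope.

(* Faces are cut out by supporting hyperplanes; the empty set and the whole of
   P are allowed. *)
Definition is_face (R : realType) (I : finType) (P F : set {ffun I -> R}) :
    Prop :=
  exists (l : {ffun I -> R}) (t : R),
    (forall x, P x -> \sum_i l i * x i <= t) /\
    F = P `&` [set x | \sum_i l i * x i = t].

(* 'Z_m is the ring of integers modulo m only when 1 < m, and every statement
   using the definitions below assumes this. *)
Definition kunz_space (R : realType) (m : nat) : Type :=
  {ffun {i : 'Z_m | i != 0} -> R}.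

(* The coordinate x_i for any residue i, with the convention x_0 = 0. *)
Definition coord (R : realType) (m : nat) (x : kunz_space R m) (i : 'Z_m) : R :=
  if insub i is Some j then x j else 0.

Definition kunz_cone (R : realType) (m : nat) : set (kunz_space R m) :=
  [set x | forall i j : 'Z_m, i != 0 -> j != 0 -> i + j != 0 ->
             coord x (i + j) <= coord x i + coord x j].

Definition trivial_kunz_subgroup (R : realType) (m : nat)
    (F : set (kunz_space R m)) : Prop :=
  forall i : 'Z_m, i != 0 -> ~ (forall x, F x -> coord x i = 0).

(* Operations on Z_m together with a nil element: Some u is the residue u and
   None is the nil element. *)
Definition nil_op (m : nat) : Type :=
  option 'Z_m -> option 'Z_m -> option 'Z_m.

Definition kunz_op (R : realType) (m : nat) (F : set (kunz_space R m)) :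
    nil_op m :=
  fun s t =>
    match s, t with
    | Some u, Some v =>
        if `[< forall x, F x -> coord x u + coord x v = coord x (u + v) >]
        then Some (u + v) else None
    | _, _ => None
    end.

Definition kunz_nilsemigroup (R : realType) (m : nat) (N : nil_op m) : Prop :=
  exists F : set (kunz_space R m),
    [/\ is_face (@kunz_cone R m) F, trivial_kunz_subgroup F & N = kunz_op F].

(* Literally this would also cover the nil element, but None = N None None is
   a sum of two nonzero elements in any Kunz nilsemigroup. *)
Definition atom (m : nat) (N : nil_op m) (p : option 'Z_m) : Prop :=
  p <> Some 0 /\
  ~ (exists s t, [/\ s <> Some 0, t <> Some 0 & p = N s t]).

Definition two_atoms (m : nat) (N : nil_op m) (p1 p2 : option 'Z_m) : Prop :=
  p1 <> p2 /\ (forall p, atom N p <-> p = p1 \/ p = p2).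

Definition nmul (m : nat) (N : nil_op m) (k : nat) (p : option 'Z_m) :
    option 'Z_m :=
  iter k (N p) (Some 0).

(* z is a factorization of n when fact_val N p1 p2 z = n. *)
Definition fact_val (m : nat) (N : nil_op m) (p1 p2 : option 'Z_m)
    (z : nat * nat) : option 'Z_m :=
  N (nmul N z.1 p1) (nmul N z.2 p2).

Definition staircase (m : nat) (N : nil_op m) (p1 p2 : option 'Z_m) : Prop :=
  forall n : option 'Z_m, n <> None -> exists! z, fact_val N p1 p2 z = n.

Definition outer_betti (m : nat) (N : nil_op m) (p1 p2 : option 'Z_m)
    (z : nat * nat) : Prop :=
  [/\ fact_val N p1 p2 z = None,
      (0 < z.1)%N -> fact_val N p1 p2 (z.1.-1, z.2) <> None &
      (0 < z.2)%N -> fact_val N p1 p2 (z.1, z.2.-1) <> None].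

(* s lists the outer Betti elements without repetition, so that there are
   exactly size s of them. *)
Definition outer_betti_elements (m : nat) (N : nil_op m)
    (p1 p2 : option 'Z_m) (s : seq (nat * nat)) : Prop :=
  uniq s /\ (forall z, outer_betti N p1 p2 z <-> z \in s).

Definition has_shape (m : nat) (N : nil_op m) (a b c d : nat) : Prop :=
  exists p1 p2 : option 'Z_m,
    [/\ two_atoms N p1 p2, staircase N p1 p2 &
        outer_betti_elements N p1 p2
          [:: (a, c); ((a + b)%N, 0%N); (0%N, (c + d)%N)]].

(* Main.v *)
(* The three outer Betti elements say that the non-nil factorizations form the
   L-shaped region S of points below (a + b, 0) and (0, c + d) and not above
   (a, c), and phi z = z.1 p1 + z.2 p2 maps S bijectively onto Z_m.  Comparing
   each outer Betti element with the point of S having the same image gives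
   the relations (a, c) ~ 0, (a + b, 0) ~ (0, d) and (0, c + d) ~ (b, 0), and
   these reduce every point of N^2 into S.  Hence the kernel of phi is the
   lattice L spanned by (a + b, -d) and (-b, c + d), which lies in g Z^2 for
   g = gcd(a, b, c, d), while Z^2 / L must be cyclic: g = 1.

   Conversely, if g = 1 then Z^2 / L is cyclic of order m = #|S|, so phi exists
   and is bijective on S.  Each of the reductions strictly decreases the linear
   form weight, so the point of the Kunz cone whose coordinate at phi z is
   weight z, for z in S, satisfies x_u + x_v = x_(u + v) exactly when the
   factorizations of u and v add up inside S.  The smallest face containing
   this point has the required nilsemigroup. *)
From mathcomp Require Import all_boot all_order all_algebra.
From mathcomp Require Import boolp classical_sets reals.
From mathcomp Require Import zify ring lra.
Require Import Defs.
Set Implicit Arguments.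
Unset Strict Implicit.
Unset Printing Implicit Defensive.
Import Order.TTheory GRing.Theory Num.Theory.
Local Open Scope ring_scope.

(** * The L-shaped region S and reduction of points of N^2 into it *)

Definition Lshape (a b c d : nat) (z : nat * nat) : bool :=
  [&& z.1 < a + b, z.2 < c + d & ~~ ((a <= z.1) && (c <= z.2))]%N.

(* Reducing by (a + b, -d) or (-b, c + d) lowers the weight by m, and reducing
   by their sum (a, c) lowers it by 2m, where m = (a + b)(c + d) - bd. *)
Definition weight (a b c d : nat) (z : nat * nat) : nat :=
  (z.1 * (c + d + d) + z.2 * (a + b + b))%N.

Definition lincomb (V : zmodType) (p q : V) (z : nat * nat) : V :=
  p *+ z.1 + q *+ z.2.

Lemma lincombD (V : zmodType) (p q : V) i j k l :
  lincomb p q ((i + k)%N, (j + l)%N) = lincomb p q (i, j) + lincomb p q (k, l).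
Proof. by rewrite /lincomb /= !mulrnDr addrACA. Qed.

(** Outside S one of the three reductions applies and lowers the weight. The group V is quantified
    after z', so that a single normal form serves both for Z_m and for Z_g, where g divides a, b, c
    and d. *)
Lemma Lshape_reduce (a b c d : nat) (z : nat * nat) :
  (0 < a)%N -> (0 < b)%N -> (0 < c)%N -> (0 < d)%N ->
  exists z', [/\ Lshape a b c d z',
    z' = z \/ (weight a b c d z' < weight a b c d z)%N &
    forall (V : zmodType) (p q : V),
      p *+ (a + b) = q *+ d -> q *+ (c + d) = p *+ b ->
      lincomb p q z' = lincomb p q z].
Proof.
move=> a0 b0 c0 d0.
have [n] := ubnP (weight a b c d z); elim: n z => // n IHn z ltzn.
have step y : (weight a b c d y < weight a b c d z)%N ->
    (forall (V : zmodType) (p q : V),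
      p *+ (a + b) = q *+ d -> q *+ (c + d) = p *+ b ->
      lincomb p q y = lincomb p q z) ->
    exists z', [/\ Lshape a b c d z',
      z' = z \/ (weight a b c d z' < weight a b c d z)%N &
      forall (V : zmodType) (p q : V),
        p *+ (a + b) = q *+ d -> q *+ (c + d) = p *+ b ->
        lincomb p q z' = lincomb p q z].
  move=> ltyz yz; have [|z' [Lz' z'y eq_y]] := IHn y.
    by apply: leq_trans ltyz _; rewrite -ltnS.
  exists z'; split=> //; last by move=> V p q pq qp; rewrite eq_y ?yz.
  by right; case: z'y => [->|/ltn_trans]; last exact.
have [Lz|] := boolP (Lshape a b c d z); first by exists z; split=> //; left.
case: z ltzn step => i j _ step.
rewrite /Lshape /= => notL.
have [ai|ltai] := leqP (a + b) i.
  apply: (step ((i - (a + b))%N, (j + d)%N)); rewrite /weight /=.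
    by rewrite -{2}(subnK ai); nia.
  move=> V p q pq qp; rewrite /lincomb /= -{2}(subnK ai) !mulrnDr.
  by rewrite -(mulrnDr p a) pq addrA addrAC.
have [cj|ltcj] := leqP (c + d) j.
  apply: (step ((i + b)%N, (j - (c + d))%N)); rewrite /weight /=.
    by rewrite -{2}(subnK cj); nia.
  move=> V p q pq qp; rewrite /lincomb /= -{2}(subnK cj) !mulrnDr.
  by rewrite -(mulrnDr q c) qp -addrA [_ *+ b + _]addrC.
have /andP[ai cj] : ((a <= i) && (c <= j))%N by lia.
apply: (step ((i - a)%N, (j - c)%N)); rewrite /weight /=.
  by rewrite -{2}(subnK ai) -{2}(subnK cj); nia.
move=> V p q pq qp; rewrite /lincomb /= -{2}(subnK ai) -{2}(subnK cj) !mulrnDr.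
(* Adding the two relations and cancelling p b + q d gives p a + q c = 0. *)
have -> : p *+ a = - (q *+ c).
  by apply/eqP; rewrite -addr_eq0 -(inj_eq (addIr (p *+ b + q *+ d)))
    addrACA -!mulrnDr pq qp add0r addrC.
by rewrite addrACA [- _ + _]addNr addr0.
Qed.

(** * Nonnegativity and subadditivity on the Kunz cone *)

Lemma coord0 (R : realType) m (x : kunz_space R m) : coord x 0 = 0.
Proof. by rewrite /coord insubF ?eqxx. Qed.

(* Sum x_(i + j) <= x_i + x_j over all j other than -i. *)
Lemma kunz_coord_opp (R : realType) m (x : kunz_space R m) i :
  kunz_cone x -> i != 0 -> coord x (- i) <= coord x i *+ (Zp_trunc m).+1.
Proof.
move=> Kx i0.
have h : \sum_(j | j != - i) coord x (i + j) <=
         \sum_(j | j != - i) (coord x i + coord x j).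
  apply: ler_sum => j ji; have [->|j0] := eqVneq j 0.
    by rewrite !addr0 coord0 addr0.
  by apply: Kx => //; rewrite addrC addr_eq0.
(* Over all j the two sums of coordinates agree; the omitted terms are x_0 = 0 on the left and
   x_(-i) on the right. *)
have e : \sum_j coord x (i + j) = \sum_j coord x j.
  by rewrite [RHS](reindex_inj (addrI i)).
move: h; rewrite big_split /= sumr_const.
have -> : #|[pred j : 'Z_m | j != - i]| = (Zp_trunc m).+1.
  by rewrite (eq_card (_ : _ =i predC1 (- i))) // cardC1 card_ord.
move: e; rewrite (bigD1 (- i)) //= subrr coord0 add0r => ->.
by rewrite (bigD1 (- i)) //=; lra.
Qed.

(* False for m = 2, where the Kunz cone is the whole line. *)
Lemma kunz_coord_ge0 (R : realType) m (x : kunz_space R m) i :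
  (2 < m)%N -> kunz_cone x -> 0 <= coord x i.
Proof.
move=> m2 Kx; have [->|i0] := eqVneq i 0; first by rewrite coord0.
have Ni0 : - i != 0 by rewrite oppr_eq0.
have := kunz_coord_opp Kx Ni0; rewrite opprK -[_ *+ _]mulr_natr.
have := kunz_coord_opp Kx i0; rewrite -[_ *+ _]mulr_natr.
have : (2 : R) <= (Zp_trunc m).+1%:R by rewrite ler_nat /Zp_trunc; lia.
move: ((Zp_trunc m).+1%:R : R) (coord x i) (coord x (- i)) => k u v k2 vu uv.
(* Chaining u <= k v and v <= k u gives u <= k^2 u, where k = m - 1 >= 2. *)
have k1 : 0 < k * k - 1 by nra.
rewrite -(pmulr_lge0 _ k1); have : 0 <= k * (u * k - v) by apply: mulr_ge0; lra.
nra.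
Qed.

(** The case i + j = 0 is not among the inequalities defining the cone; it follows from
    nonnegativity, which is where 2 < m enters. *)
Lemma kunz_coordD (R : realType) m (x : kunz_space R m) i j :
  (2 < m)%N -> kunz_cone x -> coord x (i + j) <= coord x i + coord x j.
Proof.
move=> m2 Kx.
have [->|i0] := eqVneq i 0; first by rewrite coord0 !add0r.
have [->|j0] := eqVneq j 0; first by rewrite coord0 !addr0.
have [->|ij] := eqVneq (i + j) 0; last exact: Kx.
by rewrite coord0 addr_ge0 ?kunz_coord_ge0.
Qed.

(** * Factorizations of non-nil elements, read off from the face *)

Lemma kunz_opE (R : realType) m (F : set (kunz_space R m)) u v w :
  kunz_op F (Some u) (Some v) = Some w <->
  w = u + v /\ (forall x, F x -> coord x u + coord x v = coord x (u + v)).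
Proof.
rewrite /kunz_op; case: asboolP => [h|h]; last by split=> [//|[]].
by split=> [[<-]//|[-> _]].
Qed.

Definition additive_at (R : realType) m (F : set (kunz_space R m))
    (p q : 'Z_m) (z : nat * nat) : Prop :=
  forall x, F x -> coord x (lincomb p q z) = lincomb (coord x p) (coord x q) z.

Lemma kunz_lincomb_le (R : realType) m (x : kunz_space R m) p q z :
  (2 < m)%N -> kunz_cone x ->
  coord x (lincomb p q z) <= lincomb (coord x p) (coord x q) z.
Proof.
move=> m2 Kx.
have h u k : coord x (u *+ k) <= coord x u *+ k.
  elim: k => [|k IHk]; first by rewrite !mulr0n coord0.
  by rewrite !mulrS (le_trans (kunz_coordD _ _ m2 Kx)) // lerD2l.
by rewrite (le_trans (kunz_coordD _ _ m2 Kx)) // lerD.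
Qed.

(** Write z as y plus a remainder. The subadditive bounds for y, for the remainder and for their sum
    add up to the bound at z, so equality at z forces equality in each. *)
Lemma additive_at_le (R : realType) m (F : set (kunz_space R m)) p q y z :
  (2 < m)%N -> (F `<=` @kunz_cone R m)%classic ->
  (y.1 <= z.1)%N -> (y.2 <= z.2)%N ->
  additive_at F p q z -> additive_at F p q y.
Proof.
case: y z => [k l] [i j] /= m2 FK ki lj Pz x Fx; have Kx := FK x Fx.
have := Pz x Fx; rewrite -(subnKC ki) -(subnKC lj) !lincombD.
have := kunz_coordD (lincomb p q (k, l)) (lincomb p q ((i - k)%N, (j - l)%N)) m2 Kx.
have := kunz_lincomb_le p q (k, l) m2 Kx.
have := kunz_lincomb_le p q ((i - k)%N, (j - l)%N) m2 Kx.
lra.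
Qed.

(** A sum is non-nil only if each of its steps is additive on F; conversely, additivity at z passes
    to all partial sums by [additive_at_le]. *)
Lemma kunz_fact_valE (R : realType) m (F : set (kunz_space R m)) p q z u :
  (2 < m)%N -> (F `<=` @kunz_cone R m)%classic ->
  fact_val (kunz_op F) (Some p) (Some q) z = Some u <->
  u = lincomb p q z /\ additive_at F p q z.
Proof.
move=> m2 FK.
have mulE (r : 'Z_m) k v : nmul (kunz_op F) k (Some r) = Some v <->
    v = r *+ k /\ (forall x, F x -> coord x (r *+ k) = coord x r *+ k).
  elim: k v => [|k IHk] v.
    by rewrite /nmul /=; split=> [[<-]|[-> _]//]; split=> // x _; rewrite mulr0n coord0.
  rewrite /nmul iterS -/(nmul _ k _).
  case E: (nmul _ _ _) => [w|].
    have [-> hk] := (IHk w).1 E.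
    rewrite kunz_opE -mulrS; split=> -[-> h]; split=> // x Fx.
      by rewrite -h // hk // mulrS.
    by rewrite h // hk // mulrS.
  split=> // -[_ h]; suff: nmul (kunz_op F) k (Some r) = Some (r *+ k) by rewrite E.
  apply/IHk; split=> // x Fx.
  (* Both generators are r and the second exponent is 0, so [additive_at] speaks of multiples of r
     alone. *)
  have := @additive_at_le R m F r r (k, 0%N) (k.+1, 0%N) m2 FK (leqnSn k) (leqnn 0).
  rewrite /additive_at /lincomb /= !mulr0n !addr0 => /(_ _ x Fx); rewrite addr0; apply.
  by move=> y Fy; rewrite addr0 h.
case: z => i j; rewrite /fact_val /=.
have split_add : additive_at F p q (i, j) ->
    additive_at F p q (i, 0%N) /\ additive_at F p q (0%N, j).
  by move=> h; split; apply: additive_at_le h.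
case E1: (nmul _ i _) => [u1|]; last first.
  split=> // -[_ /split_add[h _]].
  suff: nmul (kunz_op F) i (Some p) = Some (p *+ i) by rewrite E1.
  by apply/mulE; split=> // x /h; rewrite /lincomb /= !mulr0n !addr0.
case E2: (nmul _ j _) => [u2|]; last first.
  split=> // -[_ /split_add[_ h]].
  suff: nmul (kunz_op F) j (Some q) = Some (q *+ j) by rewrite E2.
  by apply/mulE; split=> // x /h; rewrite /lincomb /= !mulr0n !add0r.
have [-> h1] := (mulE _ _ _).1 E1; have [-> h2] := (mulE _ _ _).1 E2.
rewrite kunz_opE; split=> -[-> h]; split=> // x Fx.
  by rewrite /lincomb /= -h // h1 // h2.
by rewrite h1 // h2 // (h x Fx).
Qed.

(** * From a nilsemigroup of shape (a, b, c, d) to gcd 1 *)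

(** A down-closed set is determined by the minimal points of its complement: every point outside
    lies above one of them, found by descent on z.1 + z.2, and no point inside does. *)
Lemma Lshape_corners (a b c d : nat) (P : pred (nat * nat)) :
  (forall y z, (y.1 <= z.1)%N -> (y.2 <= z.2)%N -> P z -> P y) ->
  (forall z, [/\ ~~ P z, (0 < z.1)%N -> P (z.1.-1, z.2) &
                 (0 < z.2)%N -> P (z.1, z.2.-1)] <->
             z \in [:: (a, c); ((a + b)%N, 0%N); (0%N, (c + d)%N)]) ->
  P =1 Lshape a b c d.
Proof.
move=> Pdown corners.
have below z : ~~ P z -> exists y,
    [/\ (y.1 <= z.1)%N, (y.2 <= z.2)%N &
        y \in [:: (a, c); ((a + b)%N, 0%N); (0%N, (c + d)%N)]].
  have [n] := ubnP (z.1 + z.2)%N; elim: n z => // n IHn [i j] /= ltn nP.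
  have [/andP[i0 nPi]|ok1] := boolP ((0 < i)%N && ~~ P (i.-1, j)).
    have [|y [yi yj yc]] := IHn (i.-1, j) _ nPi; first by rewrite /=; lia.
    by exists y; split=> //=; move: yi => /=; lia.
  have [/andP[j0 nPj]|ok2] := boolP ((0 < j)%N && ~~ P (i, j.-1)).
    have [|y [yi yj yc]] := IHn (i, j.-1) _ nPj; first by rewrite /=; lia.
    by exists y; split=> //=; move: yj => /=; lia.
  exists (i, j); split=> //; apply/corners; split=> //= h.
    by move: ok1; rewrite h /= negbK.
  by move: ok2; rewrite h /= negbK.
move=> z; apply/idP/idP => [Pz|Lz].
  have out y : y \in [:: (a, c); ((a + b)%N, 0%N); (0%N, (c + d)%N)] ->
      ~~ ((y.1 <= z.1) && (y.2 <= z.2))%N.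
    move=> /corners[/negP nPy _ _]; apply/negP => /andP[y1 y2].
    by apply: nPy; apply: Pdown Pz.
  have := out (a, c); have := out ((a + b)%N, 0%N); have := out (0%N, (c + d)%N).
  by rewrite !inE !eqxx !orbT /Lshape /=; lia.
apply/negPn/negP => /below[y [y1 y2]].
by rewrite !inE => /or3P[] /eqP yE; move: Lz y1 y2; rewrite yE /Lshape /=; lia.
Qed.

(** If a corner and the point of S with the same image both involved p, or both q, cancelling one
    generator would leave two points of S, equal by injectivity, and the corner would lie in S. So
    (a, c) is paired with (0, 0), and the other corners with some (0, s) and (t, 0). *)
Lemma Lshape_relations (V : zmodType) (p q : V) (a b c d : nat) :
  (0 < a)%N -> (0 < b)%N -> (0 < c)%N -> (0 < d)%N ->
  (forall u, exists2 z, Lshape a b c d z & lincomb p q z = u) ->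
  (forall y z, Lshape a b c d y -> Lshape a b c d z ->
     lincomb p q y = lincomb p q z -> y = z) ->
  p *+ (a + b) = q *+ d /\ q *+ (c + d) = p *+ b.
Proof.
move=> a0 b0 c0 d0 surj inj.
have inj' i j k l : lincomb p q (i, j) = lincomb p q (k, l) ->
    Lshape a b c d (i, j) -> Lshape a b c d (k, l) -> i = k /\ j = l.
  by move=> eq_kl Lij Lkl; case: (inj (i, j) (k, l) Lij Lkl eq_kl).
have dec1 i j k l : lincomb p q (i.+1, j) = lincomb p q (k.+1, l) ->
    Lshape a b c d (k.+1, l) -> Lshape a b c d (i, j) -> i = k /\ j = l.
  rewrite /lincomb /= !mulrS -!addrA => /addrI /inj' eq_kl Lkl Lij.
  by apply: eq_kl => //; move: Lkl; rewrite /Lshape /=; lia.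
have dec2 i j k l : lincomb p q (i, j.+1) = lincomb p q (k, l.+1) ->
    Lshape a b c d (k, l.+1) -> Lshape a b c d (i, j) -> i = k /\ j = l.
  rewrite /lincomb /= !mulrSr !addrA => /addIr /inj' eq_kl Lkl Lij.
  by apply: eq_kl => //; move: Lkl; rewrite /Lshape /=; lia.
have rel_ac : p *+ a + q *+ c = 0.
  have [[[|k] [|l]] Lkl eq_kl] := surj (lincomb p q (a, c)).
  - by move: eq_kl; rewrite /lincomb /= !mulr0n addr0.
  - move: eq_kl; rewrite -(prednK c0) => /esym/dec2/(_ Lkl).
    by move: Lkl; rewrite /Lshape /=; lia.
  - move: eq_kl; rewrite -(prednK a0) => /esym/dec1/(_ Lkl).
    by move: Lkl; rewrite /Lshape /=; lia.
  - move: eq_kl; rewrite -(prednK a0) => /esym/dec1/(_ Lkl).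
    by move: Lkl; rewrite /Lshape /=; lia.
have [s lts rel_s] : exists2 s, (s < c + d)%N & p *+ (a + b) = q *+ s.
  have [[[|k] l] Lkl eq_kl] := surj (lincomb p q ((a + b)%N, 0%N)).
    exists l; first by move: Lkl; rewrite /Lshape /=; lia.
    by move: eq_kl; rewrite /lincomb /= !mulr0n addr0 add0r.
  move: eq_kl; rewrite -(prednK a0) addSn => /esym/dec1/(_ Lkl).
  by move: Lkl; rewrite /Lshape /=; lia.
have [t ltt rel_t] : exists2 t, (t < a + b)%N & q *+ (c + d) = p *+ t.
  have [[k [|l]] Lkl eq_kl] := surj (lincomb p q (0%N, (c + d)%N)).
    exists k; first by move: Lkl; rewrite /Lshape /=; lia.
    by move: eq_kl; rewrite /lincomb /= !mulr0n addr0 add0r.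
  move: eq_kl; rewrite -(prednK c0) addSn => /esym/dec2/(_ Lkl).
  by move: Lkl; rewrite /Lshape /=; lia.
(* If s < d, then (b, 0) and (0, s + c) are distinct points of S with the same image. *)
have ds : (d <= s)%N.
  rewrite leqNgt; apply/negP => ltsd.
  have : lincomb p q (b, 0%N) = lincomb p q (0%N, (s + c)%N).
    rewrite /lincomb /= !mulr0n addr0 add0r mulrnDr -rel_s mulrnDr addrAC.
    by rewrite rel_ac add0r.
  by move/inj'; rewrite /Lshape /=; lia.
have bt : (b <= t)%N.
  rewrite leqNgt; apply/negP => lttb.
  have : lincomb p q (0%N, d) = lincomb p q ((t + a)%N, 0%N).
    rewrite /lincomb /= !mulr0n addr0 add0r mulrnDr -rel_t mulrnDr addrAC.
    by rewrite [q *+ c + _]addrC rel_ac add0r.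
  by move/inj'; rewrite /Lshape /=; lia.
(* By the two bounds this point is at most (a, c). It is not (0, 0), so injectivity puts it outside
   S, and it must be (a, c). *)
have rel0 : lincomb p q ((a + b - t)%N, (c + d - s)%N) = lincomb p q (0%N, 0%N).
  rewrite /lincomb /= !mulr0n addr0 !mulrnBr ?(ltnW lts) ?(ltnW ltt) //.
  by rewrite rel_s rel_t addrA subrK subrr.
suff [e1 e2] : s = d /\ t = b by rewrite rel_s rel_t e1 e2.
have [Lz|nLz] := boolP (Lshape a b c d ((a + b - t)%N, (c + d - s)%N)).
  by case: (inj' _ _ _ _ rel0 Lz); move: Lz; rewrite /Lshape /=; lia.
by move: nLz; rewrite /Lshape /=; lia.
Qed.

Lemma Zp_lincombE m (p q : 'Z_m) z :
  lincomb p q z = (p * z.1 + q * z.2)%N%:R.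
Proof. by rewrite natrD !mulrnA !natr_Zp. Qed.

Lemma Zp_nat_eq0 m n : (1 < m)%N -> (n%:R == 0 :> 'Z_m) = (m %| n)%N.
Proof. by move=> m1; rewrite -val_eqE /= val_Zp_nat. Qed.

Lemma Lshape_Zp_gcd (m a b c d : nat) (p q : 'Z_m) : (1 < m)%N ->
  (0 < a)%N -> (0 < b)%N -> (0 < c)%N -> (0 < d)%N ->
  (forall u, exists2 z, Lshape a b c d z & lincomb p q z = u) ->
  (forall y z, Lshape a b c d y -> Lshape a b c d z ->
     lincomb p q y = lincomb p q z -> y = z) ->
  gcdn a (gcdn b (gcdn c d)) = 1%N.
Proof.
move=> m1 a0 b0 c0 d0 surj inj.
set g := gcdn a _.
have [g1|] := ltnP 1 g; last first.
  by have : (0 < g)%N; [rewrite gcdn_gt0 a0 | lia].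
have /and4P[ga gb gc gd] : [&& g %| a, g %| b, g %| c & g %| d]%N.
  by rewrite -!dvdn_gcd.
have [relp relq] := Lshape_relations a0 b0 c0 d0 surj inj.
have ker_g z : lincomb p q z = 0 -> (g %| z.1)%N && (g %| z.2)%N.
  move=> z0; have [y [Ly _ inv]] := Lshape_reduce z a0 b0 c0 d0.
  have y0 : y = (0%N, 0%N).
    apply: inj => //; first by rewrite /Lshape /=; lia.
    by rewrite inv // z0 /lincomb /= !mulr0n addr0.
  have g0 n : (g %| n)%N -> (1 : 'Z_g) *+ n = 0 by rewrite -Zp_nat_eq0 // => /eqP.
  (* Taking Z_g with generators (1, 0) and (0, 1) shows that the reduction preserves each coordinate
     of z modulo g; here it ends at (0, 0). *)
  have := inv 'Z_g 1 0; have := inv 'Z_g 0 1.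
  rewrite y0 /lincomb /= !mul0rn !mulr0n !addr0 !add0r.
  rewrite !(g0 d, g0 b, g0 (a + b)%N, g0 (c + d)%N) ?dvdn_add // => /(_ erefl erefl) h2 /(_ erefl erefl) h1.
  by rewrite -!(@Zp_nat_eq0 g) // -h1 -h2 eqxx.
have mZ : m%:R = 0 :> 'Z_m := pchar_Zp m1.
have ltpm : (p < m)%N by rewrite -[m in (_ < m)%N](Zp_cast m1) ltn_ord.
have /ker_g/andP[/= gm _] : lincomb p q (m, 0%N) = 0.
  by rewrite Zp_lincombE /= muln0 addn0 mulnC natrM mZ mul0r.
(* In the kernel because p q + q (m - p) = q m; m - p replaces -p, as coordinates are natural
   numbers. *)
have /ker_g/andP[/= gq gmp] : lincomb p q (nat_of_ord q, (m - p)%N) = 0.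
  rewrite Zp_lincombE /= [(p * q)%N]mulnC -mulnDr subnKC ?(ltnW ltpm) //.
  by rewrite mulnC natrM mZ mul0r.
have gp : (g %| p)%N by rewrite -(dvdn_addr _ gmp) subnK ?(ltnW ltpm).
(* Since g divides m, p and q, every value of [lincomb p q] is 0 modulo g, but 1 is not. *)
have [z _ /(congr1 (@nat_of_ord _))] := surj 1.
rewrite Zp_lincombE val_Zp_nat //= => /(congr1 (modn^~ g)).
rewrite modn_dvdm // (eqP (dvdn_add _ _)) ?dvdn_mulr //.
by rewrite /= !modn_small // /Zp_trunc; lia.
Qed.

(** The factorizations of non-nil elements form a down-closed set, which [Lshape_corners] identifies
    with S; existence and uniqueness in [staircase] then give surjectivity and injectivity. *)
Lemma kunz_shape_Lshape (R : realType) m (N : nil_op m) (a b c d : nat) :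
  (1 < m)%N -> kunz_nilsemigroup R N -> has_shape N a b c d ->
  exists p q : 'Z_m,
    (forall u, exists2 z, Lshape a b c d z & lincomb p q z = u) /\
    (forall y z, Lshape a b c d y -> Lshape a b c d z ->
       lincomb p q y = lincomb p q z -> y = z).
Proof.
move=> m1 [F [[l [t [_ FE]]] _ ->{N}]] [p1 [p2 [[p12 atoms] stair [_ outer]]]].
have FK : (F `<=` @kunz_cone R m)%classic by rewrite FE => x [].
have atom_Some r : atom (kunz_op F) r -> exists2 u : 'Z_m, r = Some u & u != 0.
  case: r => [u|] [u0 irr]; last by case: irr; exists None, None.
  by exists u => //; apply/eqP => u0'; apply: u0; rewrite u0'.
have [p Ep p0] := atom_Some p1 ((atoms p1).2 (or_introl erefl)).
have [q Eq q0] := atom_Some p2 ((atoms p2).2 (or_intror erefl)).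
move: p12 stair outer; rewrite {}Ep {}Eq => pq stair outer.
(* Z_2 has only one nonzero residue, while p and q are distinct and nonzero. *)
have m2 : (2 < m)%N.
  have pq' : p != q by apply/eqP => e; apply: pq; rewrite e.
  rewrite ltnNge; apply/negP => mle2.
  have := ltn_ord p; have := ltn_ord q; move: p0 q0 pq'.
  rewrite -!val_eqE /= /Zp_trunc; lia.
have valP z u := @kunz_fact_valE R m F p q z u m2 FK.
pose P z := fact_val (kunz_op F) (Some p) (Some q) z != None.
have PE z : P z <-> additive_at F p q z.
  rewrite /P; case E: fact_val => [u|]; first by have [] := (valP _ _).1 E.
  split=> // h; suff: fact_val (kunz_op F) (Some p) (Some q) z = Some (lincomb p q z).
    by rewrite E.
  exact/valP.
have PL : P =1 Lshape a b c d.
  apply: Lshape_corners => [y z y1 y2 /PE Pz|z].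
    by apply/PE; apply: additive_at_le Pz.
  rewrite -outer /P /outer_betti; split=> -[h1 h2 h3]; split.
  - by apply/eqP; rewrite -[_ == _]negbK.
  - by move=> /h2/eqP.
  - by move=> /h3/eqP.
  - by rewrite h1.
  - by move=> /h2/eqP.
  - by move=> /h3/eqP.
exists p, q; split=> [u|y z].
  have [//|z [zu _]] := stair (Some u).
  exists z; first by rewrite -PL /P zu.
  by have [-> _] := (valP _ _).1 zu.
rewrite -!PL => /PE Py /PE Pz eq_yz.
have [//|x [_ uniq_x]] := stair (Some (lincomb p q y)).
rewrite -(uniq_x y); last exact/valP.
by rewrite -(uniq_x z) //; apply/valP.
Qed.

(** * Faces given by tight inequalities, and bijections from S onto Z_m *)

Lemma coord_sum (R : realType) m (x : kunz_space R m) (u : 'Z_m) :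
  coord x u = \sum_k (val k == u)%:R * x k.
Proof.
rewrite /coord; case: insubP => [k k0 ku|].
  rewrite (bigD1 k) //= ku eqxx mul1r big1 ?addr0 // => l lk.
  by rewrite -ku val_eqE (negPf lk) mul0r.
rewrite negbK => /eqP ->; rewrite big1 // => l _.
by rewrite (negPf (valP l)) mul0r.
Qed.

(** The supporting functional is the sum over E of x_(u + v) - x_u - x_v. Each term is nonpositive
    on the cone, so the sum vanishes only where every term does. *)
Lemma kunz_tight_face (R : realType) m (E : rel 'Z_m) :
  (forall u v, E u v -> [/\ u != 0, v != 0 & u + v != 0]) ->
  is_face (@kunz_cone R m)
    [set x | kunz_cone x /\
       forall u v, E u v -> coord x u + coord x v = coord x (u + v)]%classic.
Proof.
move=> Enz; pose l : kunz_space R m := [ffun k : {i : 'Z_m | i != 0} =>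
  \sum_(e : 'Z_m * 'Z_m | E e.1 e.2)
    ((val k == e.1 + e.2)%:R - (val k == e.1)%:R - (val k == e.2)%:R)].
have lE (x : kunz_space R m) : \sum_k l k * x k =
    \sum_(e : 'Z_m * 'Z_m | E e.1 e.2)
      (coord x (e.1 + e.2) - coord x e.1 - coord x e.2).
  under eq_bigr do rewrite ffunE mulr_suml.
  rewrite exchange_big /=; apply: eq_bigr => e _.
  under eq_bigr do rewrite !mulrBl.
  by rewrite !sumrB -!coord_sum.
have le0 (x : kunz_space R m) e : kunz_cone x -> E e.1 e.2 ->
    coord x (e.1 + e.2) - coord x e.1 - coord x e.2 <= 0.
  by move=> Kx /Enz[e1 e2 e12]; have := Kx _ _ e1 e2 e12; lra.
exists l, 0; split=> [x Kx|]; first by rewrite lE sumr_le0 // => e; apply: le0.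
apply/seteqP; split=> x /= [Kx] h; split=> //.
  by rewrite lE big1 // => e /h <-; rewrite addrAC addrK subrr.
move=> u v Euv; move: h; rewrite lE => /eqP.
rewrite -oppr_eq0 -sumrN psumr_eq0; last first.
  by move=> e Ee; rewrite oppr_ge0 le0.
move=> /allP/(_ (u, v) (mem_index_enum _)); rewrite /= Euv /= => /eqP.
lra.
Qed.

(* For every t, the pair (c + d + t d, b + t (a + b)) satisfies modulo m the two
   relations that define a homomorphism from Z^2 / L to Z_m. *)
Lemma gcd_generators (a b c d : nat) :
  (0 < a)%N -> (0 < b)%N -> (0 < c)%N -> (0 < d)%N ->
  gcdn a (gcdn b (gcdn c d)) = 1%N ->
  exists t, coprime (gcdn (c + d + t * d) (b + t * (a + b)))
                    ((a + b) * c + a * d).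
Proof.
move=> a0 b0 c0 d0 g1; set m := ((a + b) * c + a * d)%N.
have m0 : (0 < m)%N by rewrite /m; nia.
(* t is coprime to gcd(c + d, b) and divisible by every other prime factor
   of m, so for a prime dividing m either the coefficient t or the part not
   involving t vanishes modulo it, but not both. *)
pose e := gcdn (c + d) b; exists (m`_(\pi(e)^'))%N; set t := (m`_ _)%N.
have e0 : (0 < e)%N by rewrite gcdn_gt0 b0 orbT.
apply/negPn/negP => ncop.
have /pdivP[r r_pr] :
    (1 < gcdn (gcdn (c + d + t * d) (b + t * (a + b))) m)%N.
  by rewrite ltn_neqAle eq_sym ncop gcdn_gt0 m0 orbT.
rewrite !dvdn_gcd -andbA => /and3P[r1 r2 rm].
have rt : (r %| t)%N = ~~ (r %| e)%N.
  have : (r \in \pi(t)) = (r \in \pi(m)) && (r \in \pi(e)^').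
    by rewrite pi_of_part.
  have -> : (r \in \pi(e)^') = (r \notin \pi(e)) by [].
  by rewrite !mem_primes r_pr m0 e0 rm part_gt0.
case re : (r %| e)%N; move: rt; rewrite re /= => rt.
  move: re; rewrite dvdn_gcd => /andP[rcd rb].
  move: r1 r2; rewrite dvdn_addr // dvdn_addr // !Euclid_dvdM // rt /= => rd.
  rewrite dvdn_addl // => ra.
  move: rcd; rewrite dvdn_addl // => rc.
  have : (r %| 1)%N by rewrite -g1 !dvdn_gcd ra rb rc rd.
  by rewrite dvdn1 => /eqP r_eq1; rewrite r_eq1 in r_pr.
move/negP: re; apply; rewrite dvdn_gcd.
move: r1 r2; rewrite dvdn_addl; last exact: dvdn_mulr.
by move=> -> ; rewrite dvdn_addl //; exact: dvdn_mulr.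
Qed.

Lemma Zp_lincomb_surj m (P Q : nat) (u : 'Z_m) :
  (1 < m)%N -> (0 < P)%N -> coprime (gcdn P Q) m ->
  exists z, lincomb (P%:R : 'Z_m) Q%:R z = u.
Proof.
move=> m1 P0 cop; case: (egcdnP Q P0) => k l eq_g _.
have mZ : m%:R = 0 :> 'Z_m := pchar_Zp m1.
have g_unit : ((gcdn P Q)%:R : 'Z_m) \is a GRing.unit.
  by rewrite unitZpE // coprime_sym.
pose n : nat := u / (gcdn P Q)%:R.
(* Bezout writes gcd(P, Q) as k P - l Q; m - 1 stands for -1, and n is the quotient of u by the unit
   gcd(P, Q). *)
exists ((k * n)%N, (m.-1 * l * n)%N).
have -> : u = (gcdn P Q)%:R * n%:R by rewrite natr_Zp mulrC divrK.
have Em : (m.-1%:R : 'Z_m) = -1.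
  by apply/eqP; rewrite -addr_eq0 natr1 prednK ?mZ // ltnW.
have := congr1 (fun i => i%:R : 'Z_m) eq_g.
rewrite natrD !natrM => /esym /(canRL (addKr _)) ->.
rewrite /lincomb /= -(mulr_natr _ (k * n)) -(mulr_natr _ (m.-1 * l * n)).
by rewrite !natrM Em; ring.
Qed.

(** S is an (a + b) by c rectangle with an a by d rectangle on top, so it has m points, and a map
    from S onto Z_m is injective by counting. *)
Lemma Lshape_Zp_inj (m a b c d : nat) (p q : 'Z_m) :
  (1 < m)%N -> m = ((a + b) * c + a * d)%N ->
  (forall u, exists2 z, Lshape a b c d z & lincomb p q z = u) ->
  forall y z, Lshape a b c d y -> Lshape a b c d z ->
    lincomb p q y = lincomb p q z -> y = z.
Proof.
move=> m1 Em surj.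
pose T : finType := ('I_(a + b) * 'I_c + 'I_a * 'I_d)%type.
pose f (x : T) : nat * nat := match x with
  | inl y => (nat_of_ord y.1, nat_of_ord y.2)
  | inr y => (nat_of_ord y.1, (c + y.2)%N) end.
have f_onto z : Lshape a b c d z -> exists x, f x = z.
  case: z => i j; rewrite /Lshape /= => Lz.
  have [jc|cj] := ltnP j c.
    have iab : (i < a + b)%N by lia.
    by exists (inl (Ordinal iab, Ordinal jc)).
  have ia : (i < a)%N by lia.
  have jd : (j - c < d)%N by lia.
  by exists (inr (Ordinal ia, Ordinal jd)); rewrite /f /= subnKC.
pose g x : 'Z_m := lincomb p q (f x).
have /fin_all_exists[h hK] u : exists x, g x = u.
  by have [z /f_onto[x <-] <-] := surj u; exists x.
have /bij_inj inj_g : bijective g.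
  apply: (bij_can_bij _ hK); apply: (inj_card_bij (can_inj hK)).
  by rewrite card_sum !card_prod !card_ord -Em Zp_cast.
by move=> y z /f_onto[y' <-] /f_onto[z' <-] /(inj_g y' z') ->.
Qed.

(** * Construction of a nilsemigroup of given shape when the gcd is 1 *)

Lemma exists_kunz_shape (R : realType) (a b c d : nat) :
  (0 < a)%N -> (0 < b)%N -> (0 < c)%N -> (0 < d)%N ->
  gcdn a (gcdn b (gcdn c d)) = 1%N ->
  exists (m : nat) (N : nil_op m),
    [/\ (1 < m)%N, kunz_nilsemigroup R N & has_shape N a b c d].
Proof.
move=> a0 b0 c0 d0 /(gcd_generators a0 b0 c0 d0)[t].
set m := ((a + b) * c + a * d)%N; set P := (c + d + t * d)%N.
set Q := (b + t * (a + b))%N => cop.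
have m2 : (2 < m)%N by rewrite /m; nia.
have m1 : (1 < m)%N := ltnW m2.
have P0 : (0 < P)%N by rewrite /P; lia.
pose p : 'Z_m := P%:R; pose q : 'Z_m := Q%:R.
have mZ : m%:R = 0 :> 'Z_m := pchar_Zp m1.
have relp : p *+ (a + b) = q *+ d.
  have PQ : (P * (a + b) = Q * d + m)%N by rewrite /P /Q /m; ring.
  by rewrite /p /q -!mulrnA PQ natrD mZ addr0.
have relq : q *+ (c + d) = p *+ b.
  have QP : (Q * (c + d) = P * b + t * m)%N by rewrite /P /Q /m; ring.
  by rewrite /p /q -!mulrnA QP natrD !natrM mZ mulr0 addr0.
have surj (u : 'Z_m) : exists2 z, Lshape a b c d z & lincomb p q z = u.
  have [z <-] := Zp_lincomb_surj u m1 P0 cop.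
  by have [y [Ly _ /(_ _ p q relp relq) <-]] := Lshape_reduce z a0 b0 c0 d0; exists y.
have inj := Lshape_Zp_inj m1 (erefl m) surj.
have [rep [repL repK]] : exists rep : 'Z_m -> nat * nat,
    (forall u, Lshape a b c d (rep u)) /\ (forall u, lincomb p q (rep u) = u).
  by have [rep repL repK] := fin_all_exists2 surj; exists rep.
have lincK z : Lshape a b c d z -> rep (lincomb p q z) = z by move=> Lz; apply: inj.
have L00 : Lshape a b c d (0%N, 0%N) by rewrite /Lshape /=; lia.
have L10 : Lshape a b c d (1%N, 0%N) by rewrite /Lshape /=; lia.
have L01 : Lshape a b c d (0%N, 1%N) by rewrite /Lshape /=; lia.
have linc00 : lincomb p q (0%N, 0%N) = 0 by rewrite /lincomb /= !mulr0n addr0.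
have linc10 : lincomb p q (1%N, 0%N) = p by rewrite /lincomb /= mulr0n addr0.
have linc01 : lincomb p q (0%N, 1%N) = q by rewrite /lincomb /= mulr0n add0r.
have rep0 : rep 0 = (0%N, 0%N) by rewrite -linc00 lincK.
have repp : rep p = (1%N, 0%N) by rewrite -[in LHS]linc10 lincK.
have repq : rep q = (0%N, 1%N) by rewrite -[in LHS]linc01 lincK.
pose w := weight a b c d.
have w_le z : rep (lincomb p q z) = z \/ (w (rep (lincomb p q z)) < w z)%N.
  have [y [Ly yz /(_ _ p q relp relq) <-]] := Lshape_reduce z a0 b0 c0 d0.
  by rewrite lincK.
pose addp (y z : nat * nat) := ((y.1 + z.1)%N, (y.2 + z.2)%N).
have lincD y z : lincomb p q (addp y z) = lincomb p q y + lincomb p q z.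
  by case: y z => [i j] [k l]; rewrite lincombD.
have wD y z : w (addp y z) = (w y + w z)%N by rewrite /w /weight /=; ring.
have w_repD (u v : 'Z_m) : rep (u + v)%R = addp (rep u) (rep v) \/
    (w (rep (u + v)%R) < w (rep u) + w (rep v))%N.
  by have := w_le (addp (rep u) (rep v)); rewrite lincD !repK wD.
have rep_gt0 (u : 'Z_m) : u != 0 -> (0 < (rep u).1 + (rep u).2)%N.
  apply: contraNltn; rewrite leqn0 addn_eq0 => /andP[/eqP u1 /eqP u2].
  by rewrite -(repK u) /lincomb u1 u2 !mulr0n addr0.
pose x0 : kunz_space R m := [ffun k : {i : 'Z_m | i != 0} => (w (rep (val k)))%:R].
have x0E (u : 'Z_m) : coord x0 u = (w (rep u))%:R.
  rewrite /coord; case: insubP => [k _ <-|]; first by rewrite ffunE.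
  by rewrite negbK => /eqP ->; rewrite rep0.
have Kx0 : kunz_cone x0.
  move=> u v _ _ _; rewrite !x0E -natrD ler_nat.
  by case: (w_repD u v) => [->|/ltnW//]; rewrite wD.
(* E records the defining inequalities of the cone that are tight at x0, so F is the smallest face
   containing x0. *)
pose E : rel 'Z_m := fun u v =>
  [&& u != 0, v != 0, u + v != 0 & coord x0 u + coord x0 v == coord x0 (u + v)].
pose F := [set x : kunz_space R m | kunz_cone x /\
  forall u v, E u v -> coord x u + coord x v = coord x (u + v)]%classic.
have FK : (F `<=` @kunz_cone R m)%classic by move=> x [].
have Fx0 : F x0 by split=> // u v /and4P[_ _ _ /eqP].
have F_repD (u v : 'Z_m) : (forall x, F x -> coord x u + coord x v = coord x (u + v)) ->
    rep (u + v)%R = addp (rep u) (rep v).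
  move=> /(_ x0 Fx0); rewrite !x0E -natrD => /eqP; rewrite eqr_nat => /eqP wuv.
  by case: (w_repD u v) => //; rewrite wuv ltnn.
have F_add y z x : Lshape a b c d y -> Lshape a b c d z ->
    Lshape a b c d (addp y z) -> F x ->
    coord x (lincomb p q y) + coord x (lincomb p q z) =
    coord x (lincomb p q y + lincomb p q z).
  move=> Ly Lz Lyz [_ EF].
  have [y0|y0] := eqVneq (lincomb p q y) 0; first by rewrite y0 coord0 !add0r.
  have [z0|z0] := eqVneq (lincomb p q z) 0; first by rewrite z0 coord0 !addr0.
  apply: EF; rewrite /E y0 z0 !x0E -lincD !lincK // wD natrD eqxx andbT /=.
  (* If the images of y and z summed to 0, then y + z, lying in S, would be (0, 0), and y would have
     image 0. *)
  apply: contraNneq y0 => /(congr1 rep); rewrite rep0 lincK // => -[e1 e2].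
  by rewrite -linc00; apply/eqP; congr lincomb; case: y {Ly Lyz} e1 e2 => i j /=;
    move=> e1 e2; congr pair; lia.
(* At x0 additivity says that z weighs as much as its normal form, so no reduction took place and z
   is in S. Conversely, a point of S is built up from (0, 0) inside S, one generator at a time. *)
have addE z : additive_at F p q z <-> Lshape a b c d z.
  split=> [/(_ x0 Fx0)|].
    have -> : lincomb (coord x0 p) (coord x0 q) z = (w z)%:R.
      rewrite !x0E repp repq /lincomb -!mulrnA -natrD /w /weight /=.
      by congr _%:R; lia.
    rewrite x0E => /eqP; rewrite eqr_nat => /eqP wz.
    have [<- //|] := w_le z.
    by rewrite wz ltnn.
  case: z => i j Lz x Fx; elim: i Lz => [|i IHi].
    elim: j => [|j IHj] Lz; first by rewrite linc00 coord0 /lincomb !mulr0n addr0.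
    have Lj : Lshape a b c d (0%N, j) by move: Lz; rewrite /Lshape /=; lia.
    have -> : (0%N, j.+1) = addp (0%N, 1%N) (0%N, j) by [].
    rewrite lincD -F_add // IHj // linc01.
    by rewrite /lincomb /= !mulr0n !add0r -mulrS.
  move=> Lz; have Li : Lshape a b c d (i, j) by move: Lz; rewrite /Lshape /=; lia.
  have -> : (i.+1, j) = addp (1%N, 0%N) (i, j) by [].
  rewrite lincD -F_add // IHi // linc10.
  by rewrite /lincomb /= addrA -mulrS.
have valP z u : fact_val (kunz_op F) (Some p) (Some q) z = Some u <->
    u = lincomb p q z /\ Lshape a b c d z.
  by rewrite kunz_fact_valE // addE.
have val_None z : fact_val (kunz_op F) (Some p) (Some q) z = None <->
    ~~ Lshape a b c d z.
  split=> [vz|]; first by apply/negP => Lz; have := (valP z _).2 (conj erefl Lz); rewrite vz.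
  case vz: fact_val => [u|//] nL; have [_ Lz] := (valP _ _).1 vz.
  by rewrite Lz in nL.
exists m, (kunz_op F); split=> //.
  exists F; split=> //.
    by apply: kunz_tight_face => u v /and4P[].
  move=> i i0 /(_ x0 Fx0)/eqP; rewrite x0E pnatr_eq0 => /eqP wi.
  by have := rep_gt0 i i0; move: wi; rewrite /w /weight; nia.
have p_neq0 : p <> 0 by move=> e; move: repp; rewrite e rep0.
have q_neq0 : q <> 0 by move=> e; move: repq; rewrite e rep0.
(* Where a sum is non-nil, representatives add up, and nonzero residues have representatives of
   degree at least 1. *)
have irred r : r <> 0 -> ((rep r).1 + (rep r).2 = 1)%N ->
    atom (kunz_op F) (Some r).
  move=> r0 r1; split; first by case.
  case=> -[u|] [[v|]] [u0 v0] // /esym/kunz_opE[ruv /F_repD].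
  rewrite -ruv => e; move: r1; rewrite e /addp /=.
  have /rep_gt0 : u != 0 by apply/eqP => u00; apply: u0; rewrite u00.
  have /rep_gt0 : v != 0 by apply/eqP => v00; apply: v0; rewrite v00.
  lia.
exists (Some p), (Some q); split.
- split=> [[pq]|r]; first by move: repp; rewrite pq repq.
  split=> [|[->|->]]; last 2 first.
  - by apply: irred; rewrite ?repp.
  - by apply: irred; rewrite ?repq.
  case: r => [u|] [u0 irr]; last by case: irr; exists None, None.
  have splits y z : rep u = addp y z -> Lshape a b c d y -> Lshape a b c d z ->
      lincomb p q y <> 0 -> lincomb p q z <> 0 -> False.
    move=> e Ly Lz y0 z0; case: irr.
    exists (Some (lincomb p q y)), (Some (lincomb p q z)).
    split; [by move=> /Some_inj/y0|by move=> /Some_inj/z0|].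
    apply/esym/kunz_opE; split; first by rewrite -lincD -e repK.
    by move=> x Fx; apply: F_add => //; rewrite -e.
  have nz z : Lshape a b c d z -> z <> (0%N, 0%N) -> lincomb p q z <> 0.
    by move=> Lz z0 e; apply: z0; rewrite -(lincK z Lz) e rep0.
  have uK := repK u; have uL := repL u.
  (* A representative of degree at least 2 splits off one generator inside S, which leaves only (1,
     0) and (0, 1) for atoms. *)
  case Eu: (rep u) splits uK uL => [[|i] j] splits uK uL.
    case: j Eu splits uK uL => [|[|j]] Eu splits uK uL.
    - by case: u0; rewrite -uK linc00.
    - by right; rewrite -uK linc01.
    - case: (splits (0%N, 1%N) (0%N, j.+1)) => //; last 2 first.
      + by rewrite linc01.
      + by apply: nz => //; move: uL; rewrite /Lshape /=; lia.
      by move: uL; rewrite /Lshape /=; lia.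
  have [[ei ej]|ij] := EM ((i, j) = (0%N, 0%N)).
    by left; rewrite -uK ei ej linc10.
  have Lij : Lshape a b c d (i, j) by move: uL; rewrite /Lshape /=; lia.
  case: (splits (1%N, 0%N) (i, j)) => //; first by rewrite linc10.
  exact: nz.
- case=> // u _; exists (rep u); split; first by apply/valP; rewrite repK.
  by move=> z /valP[-> Lz]; rewrite lincK.
split.
  by rewrite /= !inE !xpair_eqE; lia.
have val_Some z : fact_val (kunz_op F) (Some p) (Some q) z <> None <->
    Lshape a b c d z.
  split=> [vz|Lz /val_None]; last by rewrite Lz.
  by apply/negPn/negP => /val_None.
case=> i j; rewrite !inE !xpair_eqE; split=> [[/val_None h1 h2 h3]|zc].
  have {}h2 : (0 < i)%N -> Lshape a b c d (i.-1, j) by move=> /h2/val_Some.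
  have {}h3 : (0 < j)%N -> Lshape a b c d (i, j.-1) by move=> /h3/val_Some.
  by move: h1 h2 h3; rewrite /Lshape /=; lia.
split=> [|/= i0|/= j0]; [apply/val_None|apply/val_Some|apply/val_Some];
  by move: zc; rewrite /Lshape /=; lia.
Qed.

Local Close Scope ring_scope.

Theorem theorem6p11 (R : realType) (a b c d : nat)
    (ha : 0 < a) (hb : 0 < b) (hc : 0 < c) (hd : 0 < d) :
  (exists (m : nat) (N : nil_op m),
      [/\ 1 < m, kunz_nilsemigroup R N & has_shape N a b c d])
  <-> gcdn a (gcdn b (gcdn c d)) = 1.
Proof.
split=> [[m [N [m1 KN shape]]]|]; last exact: exists_kunz_shape.
have [p [q [surj inj]]] := kunz_shape_Lshape m1 KN shape.
exact: Lshape_Zp_gcd m1 ha hb hc hd surj inj.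
Qed.
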